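(* Let $(Z_k)_{k\in\mathbb N}$ be independent with $Z_k\sim N(\mu_k,1)$, $\mu_k\ge0$, $r_k=\mathbf 1(\mu_k>0)$, $p_k=1-\Phi(Z_k)$. Let $\alpha,\beta\in(0,1)$ with $\alpha\le(1-\beta)/4$, and let $(\alpha_k)_{k\ge1}$ be nonnegative with $\sum_{k=1}^\infty\alpha_k=\alpha$. The online Bonferroni test rejects iff there exists $k\in\mathbb N$ with $p_k\le\alpha_k$. (i) If $\sum_{k=1}^\infty r_k=\infty$, then a necessary condition for the online Bonferroni test to have power at least $1-\beta$ is that there exists $k\in\mathbb N$ with $r_k\mu_k\ge 0.25\big(\sqrt{2\log(k^2/\alpha)}\big)^{-1}$. (ii) If $\sum_{k=1}^\infty r_k\le M<\infty$ for a constant $M$, and $(\alpha_k)$ is nonincreasing, then the online Bonferroni test can have power at least $1-\beta$ only if there exists $k\in\mathbb N$ such that $r_k\mu_k\ge0.4\sqrt{\alpha_{k^*}}$ if $k\le k^*$, or $r_k\mu_k\ge\sqrt{\log\big(\frac{k}{4\alpha}\big)}-\sqrt{2\log\big(\frac{M}{2(1-\beta-3\alpha)}\big)}$ if $k>k^*$, where $k^*=M^2/\alpha$ and $\alpha_{k^*}$ is the $k^*$-th significance level. (iii) A sufficient condition for the online martingale Stouffer test at level $\alpha$, which rejects iff there exists $k\in\mathbb N$ with $\sum_{i=1}^k\Phi^{-1}(1-p_i)\ge C_k^\alpha k^{1/2}$, to have power at least $1-\beta$ is that there exists $k\in\mathbb N$ with $\sum_{i=1}^k\mu_ir_i\ge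(C_k^\alpha+C_k^\beta)k^{1/2}$.
   Context: $\Phi$ is the standard Gaussian CDF. For $\gamma\in(0,1)$ and $k\ge1$, $C_k^\gamma=1.7\sqrt{\log\log(2k)+0.72\log\frac{5.2}{\gamma}}$. The power of a test is the probability that it rejects. *)

(* Defs.v *)
From HB Require Import structures.
From mathcomp Require Import all_boot all_order all_algebra.
From mathcomp Require Import all_classical all_reals all_analysis.
From mathcomp Require Import finmap.
Set Implicit Arguments. Unset Strict Implicit. Unset Printing Implicit Defensive.
Import Order.TTheory GRing.Theory Num.Theory.
Import numFieldNormedType.Exports.
Local Open Scope classical_set_scope.
Local Open Scope ring_scope.

Definition Phi {R : realType} (x : R) : R := fine (normal_prob 0 1 `]-oo, x]).

Definition Phi_inv {R : realType} (y : R) : R := xget 0 [set x | Phi x = y].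

Definition pval {R : realType} (z : R) : R := 1 - Phi z.

Definition sig_ind {R : realType} (m : R) : R := if 0 < m then 1 else 0.

Definition Cconst {R : realType} (k : nat) (g : R) : R :=
  (17 / 10) * Num.sqrt (ln (ln (2 * k%:R)) + (72 / 100) * ln ((52 / 10) / g)).

Definition mutually_independent d (T : measurableType d) (R : realType)
  (P : probability T R) (I : set nat) (X : nat -> {RV P >-> R}) : Prop :=
  forall (J : {fset nat}) (B : nat -> set R),
    [set` J] `<=` I -> (forall i, i \in J -> measurable (B i)) ->
    P (\bigcap_(i in [set` J]) (X i @^-1` B i)) = (\prod_(i <- J) P (X i @^-1` B i))%E.

Definition bonf_reject d (T : measurableType d) (R : realType) (P : probability T R)
  (Z : nat -> {RV P >-> R}) (alphas : nat -> R) : set T :=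
  [set w | exists k, (0 < k)%N /\ pval (Z k w) <= alphas k].

Definition stouffer_reject d (T : measurableType d) (R : realType) (P : probability T R)
  (Z : nat -> {RV P >-> R}) (alpha : R) : set T :=
  [set w | exists k, (0 < k)%N /\
     Cconst k alpha * Num.sqrt k%:R <= \sum_(1 <= i < k.+1) Phi_inv (1 - pval (Z i w))].

Arguments mutually_independent {d T R} P I X.

(* Main.v *)
(* (i), (ii): {pval <= a} is empty or lies in a ray [u, +oo[ of standard Gaussian
   mass at most a, so by a union bound only Gaussian tails matter. In (i),
   cutting [u, +oo[ at L_k = sqrt (2 ln (k^2 / alpha)) shows that, as L_k mu_k <= 1/4,
   step k rejects with probability at most e^(1/4) (alpha_k + alpha / (2 k^2)), and
   these sum to at most 2 e^(1/4) alpha < 4 alpha <= 1 - beta. In (ii), a null step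
   costs alpha_k; an early signal costs at most mu_k more, since the Gaussian density
   is below 1; for a late signal, alpha_k <= alpha / k forces u to exceed
   sqrt (ln (k / (4 alpha))), because the tail at y is above exp (- y^2) / 4.
   (iii): S_k - E S_k satisfies Chernoff's bound exp (- x^2 / 2) at - x sqrt k, and
   exp (- (C_k^beta)^2 / 2) <= beta. *)
Require Import Defs.
From HB Require Import structures.
From mathcomp Require Import all_boot all_order all_algebra.
From mathcomp Require Import finmap.
From mathcomp Require Import all_classical all_reals all_analysis.
From mathcomp Require Import measurable_realfun.
From mathcomp Require Import ring lra zify.
Import Order.TTheory GRing.Theory Num.Theory.
Import numFieldNormedType.Exports.
Import HBNNSimple.
Local Open Scope classical_set_scope.
Local Open Scope ring_scope.

(** * Gaussian tails *)

(** Integrating a comparison of densities over [D]. The tail and splitting bounds below use it, so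
    each comes down to an inequality between exponents. *)
Lemma normal_prob_le (R : realType) (m s m' s' c : R) (D : set R) :
  measurable D -> 0 <= c ->
  (forall x, D x -> normal_pdf m s x <= c * normal_pdf m' s' x) ->
  (normal_prob m s D <= c%:E * normal_prob m' s' D)%E.
Proof.
move=> mD c0 H; rewrite /normal_prob.
rewrite -ge0_integralZl//; last 2 first.
- by apply/measurable_EFinP/measurable_funTS; exact: measurable_normal_pdf.
- by move=> x _; rewrite lee_fin normal_pdf_ge0.
apply: ge0_le_integral => //.
- by move=> x _; rewrite lee_fin normal_pdf_ge0.
- by apply/measurable_EFinP/measurable_funTS; exact: measurable_normal_pdf.
- apply: measurable_funeM.
  by apply/measurable_EFinP/measurable_funTS; exact: measurable_normal_pdf.
Qed.

Lemma normal_prob_shift (R : realType) (m s c a : R) : s != 0 ->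
  normal_prob (m + c) s `[a + c, +oo[ = normal_prob m s `[a, +oo[.
Proof.
move=> s0; pose F (x : R) := x + c.
have dF : (F^`())%classic = cst 1.
  by apply/funext => x; rewrite derive1E deriveD// derive_cst derive_id addr0.
have cF : continuous F.
  by move=> x; apply: cvgD; [exact: cvg_id|exact: cvg_cst].
rewrite /normal_prob -/(F a) increasing_ge0_integration_by_substitutiony//.
- apply: eq_integral => x _; congr EFin.
  rewrite fctE dF /= mulr1 !normal_pdfE// /normal_fun /F.
  by have -> : x + c - (m + c) = x - m by ring.
- by move=> x y _ _; rewrite ltrD2r.
- by rewrite dF => x _; exact: cvg_cst.
- by rewrite dF; exact: is_cvg_cst.
- by rewrite dF; exact: is_cvg_cst.
- by split; [move=> x _; exact: derivableD|apply: cvg_at_right_filter; exact: cF].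
- apply/cvgryPge => A; near=> x; rewrite -lerBlDr.
  by near: x; apply: nbhs_pinfty_ge; rewrite num_real.
- by apply: continuous_subspaceT; exact: continuous_normal_pdf.
- by move=> x _; exact: normal_pdf_ge0.
Unshelve. all: by end_near.
Qed.

(** After a shift to mean 0 the density is even, so the ray carries half of the total mass 1. *)
Lemma normal_prob_half (R : realType) (m s : R) : s != 0 ->
  normal_prob m s `[m, +oo[ = (1 / 2)%:E.
Proof.
move=> s0.
rewrite -[in LHS](add0r m) normal_prob_shift//.
have := @integral_normal_pdf R 0 s.
rewrite ge0_symfun_integralT; last 3 first.
- by move=> x; exact: normal_pdf_ge0.
- by move=> x; exact: continuous_normal_pdf.
- by move=> x /=; rewrite !normal_pdfE// /normal_fun !subr0 sqrrN.
rewrite -set_itvcy -[X in (_ * X)%E]/(normal_prob 0 s `[0, +oo[).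
have <- := @fineK _ (normal_prob 0 s `[0, +oo[); last exact: fin_num_measure.
by rewrite -EFinM => -[] H; congr EFin; lra.
Qed.

Lemma normal_pdf1E (R : realType) (m x : R) :
  normal_pdf m 1 x = normal_peak 1 * expR (- (x - m) ^+ 2 / 2).
Proof. by rewrite normal_pdfE ?oner_eq0// /normal_fun expr1n. Qed.

(** For x >= a >= m, (x - m)^2 >= (a - m)^2 + (x - a)^2. So the density of mean [m] is dominated by
    exp (- (a - m)^2 / 2) times that of mean [a], whose ray at [a] has mass 1/2. *)
Lemma normal_prob_tail_le (R : realType) (m a : R) : m <= a ->
  (normal_prob m 1 `[a, +oo[ <= (expR (- (a - m) ^+ 2 / 2) / 2)%:E)%E.
Proof.
move=> ma.
have -> : (expR (- (a - m) ^+ 2 / 2) / 2)%:E =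
  ((expR (- (a - m) ^+ 2 / 2))%:E * normal_prob a 1 `[a, +oo[)%E.
  by rewrite normal_prob_half ?oner_eq0// -EFinM mul1r.
apply: normal_prob_le => //.
move=> x /=; rewrite in_itv/= andbT => ax.
rewrite !normal_pdf1E mulrCA ler_wpM2l ?normal_peak_ge0// -expRD ler_expR.
have : 0 <= (x - a) * (a - m) by rewrite mulr_ge0 ?subr_ge0.
nra.
Qed.

(* As (y + t)^2 <= 2 y^2 + 2 t^2, compare with the density of mean y and variance 1/2. *)
Lemma normal_prob_tail_gt (R : realType) (y : R) : 0 <= y ->
  ((expR (- y ^+ 2) / 4)%:E < normal_prob 0 1 `[y, +oo[)%E.
Proof.
move=> y0.
pose s : R := (Num.sqrt 2)^-1.
have s0 : s != 0 by rewrite invr_eq0 sqrtr_eq0 -ltNge.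
have s2 : s ^+ 2 = 1 / 2 by rewrite exprVn sqr_sqrtr// mul1r.
have sgt0 : 0 < s by rewrite invr_gt0 sqrtr_gt0.
have peakE : normal_peak 1 = s * normal_peak s.
  rewrite /normal_peak expr1n s2 mul1r /s.
  have H (p : R) : p *+ 2 = 2 * (1 / 2 * p *+ 2) by rewrite !mulr2n; field.
  rewrite [pi *+ 2]H.
  by rewrite sqrtrM// invfM.
have : (normal_prob y s `[y, +oo[ <=
   (s^-1 * expR (y ^+ 2))%:E * normal_prob 0 1 `[y, +oo[)%E.
  apply: normal_prob_le => //; first by rewrite mulr_ge0 ?expR_ge0// invr_ge0 ltW.
  move=> x /=; rewrite in_itv/= andbT => yx.
  rewrite !normal_pdfE ?oner_eq0// peakE.
  rewrite [leRHS](_ : _ = normal_peak s * (expR (y ^+ 2) * normal_fun 0 1 x)); last by field.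
  rewrite ler_wpM2l ?normal_peak_ge0// /normal_fun -expRD ler_expR s2 expr1n.
  (* The exponents differ by half of this square: y^2 - x^2 / 2 + (x - y)^2 = (x - 2 y)^2 / 2. *)
  have : 0 <= (x - 2 * y) ^+ 2 by exact: sqr_ge0.
  have -> : 1 / 2 *+ 2 = 1 :> R by rewrite mulr2n; lra.
  by rewrite divr1 subr0; lra.
rewrite normal_prob_half//.
have <- := @fineK _ (normal_prob 0 1 `[y, +oo[); last exact: fin_num_measure.
rewrite -EFinM lee_fin lte_fin -mulrA.
rewrite ler_pdivlMl// => H.
have H2 : 0 < expR (- y ^+ 2) by exact: expR_gt0.
have H3 : s / 2 * expR (- y ^+ 2) <= fine (normal_prob 0 1 `[y, +oo[).
  rewrite -ler_pdivlMr// -expRN opprK [leRHS]mulrC.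
  by apply: le_trans H; lra.
(* The comparison yields s / 2 times exp (- y^2), and s = 1 / sqrt 2 > 1/2 makes the bound with 1/4
   strict. *)
have s1 : 1 / 2 < s by nra.
by nra.
Qed.

Lemma normal_peak1_le1 (R : realType) : normal_peak (1 : R) <= 1.
Proof.
rewrite /normal_peak expr1n mul1r invf_le1 ?sqrtr_gt0; last first.
  by rewrite mulrn_wgt0// pi_gt0.
rewrite -[leLHS]sqrtr1 ler_sqrt; last by rewrite mulrn_wge0// pi_ge0.
have := @pi_ge2 R; rewrite -mulr_natr; lra.
Qed.

Lemma normal_prob_ray_lipschitz (R : realType) (m a b : R) : a <= b ->
  (normal_prob m 1 `[a, +oo[ <= normal_prob m 1 `[b, +oo[ + (b - a)%:E)%E.
Proof.
move=> ab.
have -> : `[a, +oo[%classic = `[a, b[%classic `|` `[b, +oo[%classic :> set R.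
  by apply: itv_bndbnd_setU; rewrite // bnd_simp.
apply: (le_trans (measureU2 _ _ _)) => //=.
rewrite addeC leeD2l//.
apply: (@le_trans _ _ (\int[lebesgue_measure]_(x in `[a, b[) 1)%E).
  apply: ge0_le_integral => //.
  - by move=> x _; rewrite lee_fin normal_pdf_ge0.
  - by apply/measurable_EFinP/measurable_funTS; exact: measurable_normal_pdf.
  - move=> x _; rewrite lee_fin; apply: (le_trans (normal_pdf_ub _ _ (oner_neq0 _))).
    exact: normal_peak1_le1.
rewrite integral_cst//= lebesgue_measure_itv/= mul1e lte_fin.
by case: ifPn => [_|_]; rewrite ?EFinB// lee_fin subr_ge0.
Qed.

(** The likelihood ratio of mean [m] to mean 0 is exp (x m - m^2 / 2), which is at most exp (L m) up
    to [L]. Beyond [L] the whole tail is charged. *)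
Lemma normal_prob_ray_split (R : realType) (m a L : R) : 0 <= m ->
  (normal_prob m 1 `[a, +oo[ <=
   (expR (L * m))%:E * normal_prob 0 1 `[a, +oo[ + normal_prob m 1 `[L, +oo[)%E.
Proof.
move=> m0.
have m1 : measurable (`[a, +oo[ `&` `]-oo, L] : set R) by exact: measurableI.
apply: (@le_trans _ _ (normal_prob m 1 (`[a, +oo[ `&` `]-oo, L]) + normal_prob m 1 `[L, +oo[)%E).
  apply: (le_trans _ (measureU2 _ _ _)) => //.
  apply: le_measure; rewrite ?inE//; first exact: measurableU.
  move=> x/=; rewrite !in_itv/= !andbT => ax.
  by have [xL|Lx] := leP x L; [left|right; exact: ltW].
rewrite leeD2r//.
apply: (@le_trans _ _ ((expR (L * m))%:E * normal_prob 0 1 (`[a, +oo[ `&` `]-oo, L])))%E.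
  apply: normal_prob_le => //.
  move=> x /= [_]; rewrite in_itv/= => xL.
  rewrite !normal_pdf1E mulrCA ler_wpM2l ?normal_peak_ge0// -expRD ler_expR.
  by nra.
apply: lee_wpmul2l; first by rewrite lee_fin expR_ge0.
by apply: le_measure; rewrite ?inE//; move=> x [].
Qed.

(** * p-values *)

Lemma PhiE (R : realType) (x : R) : (Phi x)%:E = normal_prob 0 1 `]-oo, x].
Proof. by rewrite fineK// fin_num_measure. Qed.

Lemma pvalE (R : realType) (x : R) : (pval x)%:E = normal_prob 0 1 `]x, +oo[.
Proof.
rewrite /pval EFinB PhiE -[X in (X - _)%E](@probability_setT _ _ _ (normal_prob (0:R) 1)).
rewrite -(itv_setU_setT false x) measureU//=; last first.
  by rewrite -subset0 => y [] /=; rewrite !in_itv/= andbT leNgt => /negP.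
by rewrite [X in (X - _)%E]addeC addeK// fin_num_measure.
Qed.

Lemma Phi_lt (R : realType) : {homo @Phi R : x y / x < y}.
Proof.
move=> x y xy; rewrite -lte_fin !PhiE.
have -> : `]-oo, y]%classic = `]-oo, x]%classic `|` `]x, y]%classic :> set R.
  by apply: itv_bndbnd_setU; rewrite // bnd_simp ltW.
rewrite measureU//=; last first.
  by rewrite -subset0 => z [] /=; rewrite !in_itv/= leNgt => /negP xz /andP[].
rewrite -[ltRHS]/(_ + _)%E lteDl ?fin_num_measure//.
(* A positive lower bound of the density on ]x, y], since z^2 <= x^2 + y^2 there whatever the
   signs. *)
pose c : R := normal_peak 1 * expR (- (x ^+ 2 + y ^+ 2) / 2).
have c0 : 0 < c by rewrite mulr_gt0 ?expR_gt0// normal_peak_gt0// oner_eq0.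
apply: (@lt_le_trans _ _ (\int[lebesgue_measure]_(z in `]x, y]) c%:E)%E).
  rewrite integral_cst//= lebesgue_measure_itv/= lte_fin xy -EFinB -EFinM lte_fin.
  by rewrite mulr_gt0// subr_gt0.
apply: ge0_le_integral => //.
- by move=> z _; rewrite lee_fin ltW.
- by apply/measurable_EFinP/measurable_funTS; exact: measurable_normal_pdf.
- move=> z /=; rewrite in_itv/= => /andP[xz zy].
  rewrite lee_fin normal_pdf1E ler_wpM2l ?normal_peak_ge0// ler_expR subr0.
  have [z0|z0] := leP 0 z; nra.
Qed.

(** Strict monotonicity makes the preimage unique, and [x] itself is one, so [xget] never falls back
    on its default 0. *)
Lemma Phi_inv_Phi (R : realType) (x : R) : Phi_inv (Phi x) = x.
Proof.
rewrite /Phi_inv; case: xgetP => [y -> /= yx|].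
  move: yx; set z := xget _ _ => zx.
  by have [/Phi_lt|/Phi_lt|//] := ltgtP z x; rewrite zx ltxx.
by move=> /(_ x erefl).
Qed.

Lemma pval_nonincreasing (R : realType) : {homo @pval R : x y / x <= y >-> y <= x}.
Proof.
move=> x y; rewrite le_eqVlt => /predU1P[->//|/Phi_lt /ltW xy].
by rewrite lerD2l lerN2.
Qed.

Lemma measurable_pval_le (R : realType) (a : R) : measurable [set z : R | pval z <= a].
Proof.
apply: is_interval_measurable => x y /= xa ya z /andP[xz _].
by apply: le_trans xa; exact: pval_nonincreasing.
Qed.

(** The rays ]-n, +oo[ increase to the whole line, so their masses [pval (- n)] tend to 1. *)
Lemma pval_gt (R : realType) (a : R) : a < 1 -> exists z : R, a < pval z.
Proof.
move=> a1; apply: contrapT => /forallNP H.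
pose F n : set R := `](- n%:R), +oo[%classic.
have FT : \bigcup_n F n = setT.
  rewrite -subTset => t _; exists (Num.truncn (- t)).+1 => //.
  by rewrite /F/= in_itv/= andbT ltrNl truncnS_gt.
have : normal_prob (0:R) 1 (F n) @[n --> \oo] --> normal_prob (0:R) 1 (\bigcup_n F n).
  apply: nondecreasing_cvg_mu => //; rewrite ?FT//.
    by move=> n; exact: measurable_itv.
  move=> m n mn; apply/subsetPset => x; rewrite /F/= !in_itv/= !andbT.
  by apply: le_lt_trans; rewrite lerN2 ler_nat.
rewrite FT probability_setT => F1.
have : (1 <= a%:E)%E.
  rewrite -(cvg_lim _ F1)//; apply: lime_le; first by apply/cvg_ex; exists 1%E.
  by apply: nearW => n; rewrite -pvalE lee_fin leNgt; apply/negP/H.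
by rewrite lee_fin leNgt a1.
Qed.

(** The endpoint is the infimum of the rejection region, which is finite because some p-value
    exceeds [a]. The region is empty for instance when a = 0. *)
Lemma pval_le_ray (R : realType) (a : R) : a < 1 ->
  [set z : R | pval z <= a] = set0 \/
  exists m, [set z : R | pval z <= a] `<=` `[m, +oo[ /\
    (normal_prob 0 1 `[m, +oo[ <= a%:E)%E.
Proof.
move=> a1; set A := [set z | _].
have [A0|/set0P[z Az]] := eqVneq A set0; [by left|right].
have [w aw] := @pval_gt R a a1.
have lbA : lbound A w.
  move=> x /= xa; rewrite leNgt; apply/negP => xw.
  have := lt_le_trans aw (le_trans (pval_nonincreasing _ _ _ (ltW xw)) xa).
  by rewrite ltxx.
have hiA : has_inf A by split; [exists z|exists w].
exists (inf A); split.
  by move=> x Ax /=; rewrite in_itv/= andbT; apply: ge_inf => //; exists w.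
apply/lee_addgt0Pr => e e0.
have e2 : 0 < e / 2 by lra.
have [x Ax xe] := inf_adherent e2 hiA.
have ix : inf A <= x by apply: ge_inf => //; exists w.
(* Stepping strictly past [x] puts the closed ray inside ]x, +oo[, of mass [pval x] <= a. The total
   displacement from [inf A] stays below [e], and so does the mass lost. *)
have ixe : inf A <= x + e / 2 by lra.
apply: (le_trans (normal_prob_ray_lipschitz _ _ _ _ ixe)).
apply: leeD; last by rewrite lee_fin; lra.
apply: (@le_trans _ _ (pval x)%:E); last by rewrite lee_fin.
rewrite pvalE; apply: le_measure; rewrite ?inE//.
by move=> y /=; rewrite !in_itv/= !andbT => ?; lra.
Qed.

(** * Expectations of products of independent variables *)

(** Monotone convergence, with a weight [G], along the simple functions that increase to [f]. *)
Lemma ge0_integral_cvg_nnsfun (d d' : measure_display) (T : measurableType d)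
    (T' : measurableType d') (R : realType) (P : {measure set T -> \bar R})
    (G : T -> R) (X : T -> T') (f : T' -> R) (mf : measurable_fun setT (EFin \o f)) :
  measurable_fun setT G -> (forall t, 0 <= G t) -> measurable_fun setT X ->
  (forall x, 0 <= f x) ->
  (\int[P]_t (G t * nnsfun_approx measurableT mf n (X t))%:E)%E @[n --> \oo] -->
  (\int[P]_t (G t * f (X t))%:E)%E.
Proof.
move=> mG G0 mX f0; set h := nnsfun_approx _ _.
have -> : (\int[P]_t (G t * f (X t))%:E =
    \int[P]_t limn (fun n => (G t * h n (X t))%:E))%E.
  apply: eq_integral => t _; apply/esym/cvg_lim => //.
  under eq_fun do rewrite EFinM.
  rewrite EFinM; apply: cvgeZl => //.
  by apply: cvg_nnsfun_approx => // x _; rewrite lee_fin.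
apply: cvg_monotone_convergence => //.
- move=> n; apply/measurable_EFinP/measurable_funM => //.
  by apply: measurableT_comp.
- by move=> n t _; rewrite lee_fin mulr_ge0.
- move=> t _ m n mn; rewrite lee_fin ler_wpM2l//.
  exact/lefP/nd_nnsfun_approx.
Qed.

Lemma ge0_integral_mul_nnsfun_comp (d d' : measure_display) (T : measurableType d)
    (T' : measurableType d') (R : realType) (P : {measure set T -> \bar R})
    (G : T -> R) (X : T -> T') (h : {nnsfun T' >-> R}) :
  measurable_fun setT G -> (forall t, 0 <= G t) -> measurable_fun setT X ->
  (\int[P]_t (G t * h (X t))%:E = \sum_(y \in range h)
     y%:E * \int[P]_(t in X @^-1` (h @^-1` [set y])) (G t)%:E)%E.
Proof.
move=> mG G0 mX.
have mA y : measurable (X @^-1` (h @^-1` [set y])).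
  by rewrite -[X in measurable X]setTI; apply: mX.
under eq_integral => t _.
  rewrite fimfunE EFinM -fsumEFin// ge0_mule_fsumr; last first.
    by move=> r; rewrite EFinM nnfun_muleindic_ge0.
  over.
rewrite ge0_integral_fsum//; last 2 first.
- move=> r; apply: emeasurable_funM; first exact/measurable_EFinP.
  apply/measurable_EFinP; apply: measurable_funM => //.
  by apply: measurableT_comp.
- move=> n x _; apply: mule_ge0; first by rewrite lee_fin.
  by rewrite EFinM nnfun_muleindic_ge0.
apply: eq_fsbigr => y /set_mem [x _ <-].
rewrite [in RHS]integral_mkcond -ge0_integralZl//; last first.
- by rewrite lee_fin.
- by move=> t _; apply: erestrict_ge0 => // ?; rewrite lee_fin.
- apply/(measurable_restrictT _ _).1 => //.
  by apply/measurable_EFinP/measurable_funTS.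
apply: eq_integral => t _; rewrite patchE; case: ifPn => [/set_mem /= tA|/negP tA].
  by rewrite indicE mem_set//= mulr1 muleC.
by rewrite indicE memNset//= ?mulr0 ?mule0// => tA'; apply: tA; exact: mem_set.
Qed.

(** The hypothesis says that [X] pushes the measure of density [G] forward to c Q. The identity
    passes from events to simple functions and then to monotone limits. It serves both for
    independence and for integrating against a density ([X] the identity). *)
Lemma ge0_integral_mul_comp (d d' : measure_display) (T : measurableType d)
    (T' : measurableType d') (R : realType) (P : {measure set T -> \bar R})
    (Q : {measure set T' -> \bar R}) (G : T -> R) (X : T -> T') (c : R) (f : T' -> R) :
  measurable_fun setT G -> (forall t, 0 <= G t) -> measurable_fun setT X ->
  (forall B, measurable B ->
    (\int[P]_(t in X @^-1` B) (G t)%:E = c%:E * Q B)%E) ->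
  measurable_fun setT f -> (forall x, 0 <= f x) ->
  (\int[P]_t (G t * f (X t))%:E = c%:E * \int[Q]_x (f x)%:E)%E.
Proof.
move=> mG G0 mX indep mf f0.
have mEf : measurable_fun setT (EFin \o f) by exact/measurable_EFinP.
(* The integral against [Q] is the case of weight 1 and identity map, so the same two lemmas treat
   both sides. *)
have id1 (g : T' -> R) :
    (\int[Q]_x (cst 1 x * g (idfun x))%:E = \int[Q]_x (g x)%:E)%E.
  by apply: eq_integral => t _; rewrite mul1r.
have step (h : {nnsfun T' >-> R}) :
    (\int[P]_t (G t * h (X t))%:E = c%:E * \int[Q]_x (h x)%:E)%E.
  rewrite ge0_integral_mul_nnsfun_comp// -id1.
  rewrite (@ge0_integral_mul_nnsfun_comp _ _ _ _ _ Q (cst 1) idfun)//;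
    last exact: measurable_id.
  rewrite ge0_mule_fsumr.
    apply: eq_fsbigr => y _; rewrite indep// muleCA; congr (_ * (_ * _))%E.
    by rewrite preimage_id (eq_integral (cst 1%E))// integral_cst ?mul1e.
  (* Nonnegativity is asked for every [y]; a value not taken by [h], possibly negative, has an empty
     preimage and contributes 0. *)
  move=> y; have [[x _ <-]|yh] := pselect (range h y).
    by rewrite mule_ge0 ?lee_fin// integral_ge0// => ? _; rewrite lee_fin.
  by rewrite preimage10// integral_set0 mule0.
have L := @ge0_integral_cvg_nnsfun _ _ _ _ _ P _ _ _ mEf mG G0 mX f0.
rewrite (eq_cvg _ _ (fun n => step _)) in L.
apply: (cvg_unique _ L) => //; apply: cvgeZl => //.
have M := @ge0_integral_cvg_nnsfun _ _ _ _ _ Q (cst 1) idfun f mEf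
  (measurable_cst _) (fun=> ler01) (@measurable_id _ _ _) f0.
by rewrite id1 (eq_cvg _ _ (fun n => id1 _)) in M.
Qed.

(* The events over K make the induction on s go through: the indicators of one more
   event Z_i in B' are replaced by f_i (Z_i). *)
Lemma ge0_integral_prod_indep (d : measure_display) (T : measurableType d)
    (R : realType) (P : probability T R) (I : set nat) (Z : nat -> {RV P >-> R})
    (f : nat -> R -> R) (e : nat -> R) (s : seq nat) :
  mutually_independent P I Z ->
  (forall i, measurable_fun setT (f i)) -> (forall i x, 0 <= f i x) ->
  (forall i, I i -> (\int[distribution P (Z i)]_x (f i x)%:E = (e i)%:E)%E) ->
  uniq s -> [set` s] `<=` I ->
  forall (K : {fset nat}) (B : nat -> set R), [set` K] `<=` I ->
  (forall i, measurable (B i)) -> (forall i, i \in s -> i \notin K) ->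
  (\int[P]_(t in \bigcap_(i in [set` K]) (Z i @^-1` B i)) (\prod_(i <- s) f i (Z i t))%:E =
    (\prod_(i <- s) e i)%:E * \prod_(i <- K) P (Z i @^-1` B i))%E.
Proof.
move=> indep mf f0 fe.
have mcap (K : {fset nat}) (B : nat -> set R) : (forall i, measurable (B i)) ->
    measurable (\bigcap_(i in [set` K]) (Z i @^-1` B i)).
  move=> mB; apply: fin_bigcap_measurable => // i _.
  by rewrite -[X in measurable X]setTI; exact: measurable_funPT.
have mprod (s' : seq nat) : measurable_fun setT (fun t => \prod_(i <- s') f i (Z i t)).
  by apply: measurable_prod => i _; apply: measurableT_comp.
elim: s => [_ _ K B KI mB _|i s IH].
  under eq_integral do rewrite big_nil.
  rewrite big_nil mul1e integral_cst ?mul1e; last exact: mcap.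
  by apply: indep.
move=> /= /andP[is_ us] sI K B KI mB sK.
have Ii : I i by apply: sI; rewrite /= inE eqxx.
have iK : i \notin K by apply: sK; rewrite inE eqxx.
set A := \bigcap_(i in [set` K]) _.
have mA : measurable A by exact: mcap.
have finK : (\prod_(j <- K) P (Z j @^-1` B j))%E \is a fin_num.
  apply: prode_fin_num => j _; apply: fin_num_measure.
  by rewrite -[X in measurable X]setTI; exact: measurable_funPT.
rewrite integral_mkcond.
(* The factor of index [i] is split off; the weight is the rest, and its integral over an event of
   [Z i] is given by the induction hypothesis with [i] added to [K]. *)
transitivity (\int[P]_t ((\1_A t * \prod_(j <- s) f j (Z j t)) * f i (Z i t))%:E)%E.
  apply: eq_integral => t _; rewrite patchE indicE big_cons.
  by case: ifPn => _; rewrite ?mul1r ?mul0r// mulrC.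
rewrite (@ge0_integral_mul_comp _ _ _ _ _ P (distribution P (Z i)) _ _
  (\prod_(j <- s) e j * fine (\prod_(j <- K) P (Z j @^-1` B j))%E))//.
- by rewrite fe// big_cons -[in RHS](fineK finK) -!EFinM; congr EFin; ring.
- by apply: measurable_funM => //; exact: measurable_indic.
- by move=> t; rewrite mulr_ge0// prodr_ge0.
- move=> B' mB'.
  (* Since [i] is not in [K], the family is unchanged there. *)
  pose B'' j := if j == i then B' else B j.
  have eqB'' j : j \in K -> B'' j = B j.
    by move=> jK; rewrite /B''; case: eqP => // ji; rewrite -ji jK in iK.
  have sI' : [set` s] `<=` I by move=> j /= js; apply: sI; rewrite /= inE js orbT.
  have KI' : [set` (i |` K)%fset] `<=` I.
    by move=> j /=; rewrite in_fset1U => /orP[/eqP->//|]; exact: KI.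
  have mB'' j : measurable (B'' j) by rewrite /B''; case: ifP.
  have sK' j : j \in s -> j \notin (i |` K)%fset.
    move=> js; rewrite in_fset1U negb_or sK ?inE ?js ?orbT// andbT.
    by apply: contraNneq is_ => <-.
  have := IH us sI' _ _ KI' mB'' sK'.
  rewrite big_fsetU1//= {2}/B'' eqxx.
  rewrite [in X in (_ * (_ * X))%E](eq_big_seq _ (fun j jK =>
    congr1 (fun b => P (Z j @^-1` b)) (eqB'' j jK))).
  rewrite EFinM fineK// -muleA [X in (_ * X)%E]muleC => <-.
  rewrite [LHS]integral_mkcond [RHS]integral_mkcond.
  have -> : \bigcap_(j in [set` (i |` K)%fset]) (Z j @^-1` B'' j) = Z i @^-1` B' `&` A.
    apply/seteqP; split=> [t tiK|t [tB' tA] j /=].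
      split; first by have := tiK i; rewrite /B'' eqxx; apply; rewrite /= in_fset1U eqxx.
      move=> j /= jK; rewrite -eqB''//; apply: tiK.
      by rewrite /= in_fset1U jK orbT.
    by rewrite in_fset1U => /orP[/eqP->|jK]; rewrite /B'' ?eqxx// -/(B'' j) eqB''//; exact: tA.
  apply: eq_integral => t _; rewrite !patchE indicE in_setI.
  by case: ifPn => //= _; case: ifPn => _; rewrite ?mul1r// mul0r.
Qed.

(** * The Stouffer test *)

Lemma normal_prob_mgf (R : realType) (Q : {measure set R -> \bar R}) (m l : R) :
  (forall A, measurable A -> Q A = normal_prob m 1 A) ->
  (\int[Q]_x (expR (l * (x - m)))%:E = (expR (l ^+ 2 / 2))%:E)%E.
Proof.
move=> QE.
have me : measurable_fun setT (fun x : R => expR (l * (x - m))).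
  by apply: measurableT_comp => //; apply: measurable_funM => //; exact: measurable_funB.
have := @ge0_integral_mul_comp _ _ _ _ R lebesgue_measure Q
  (normal_pdf m 1) idfun 1 _ (measurable_normal_pdf _ _) (normal_pdf_ge0 _ _)
  (@measurable_id _ _ _) (fun B mB => esym (etrans (mul1e _) (QE B mB))) me
  (fun=> expR_ge0 _).
rewrite mul1e => <-.
(* Exponential tilting: completing the square moves the mean to m + l, and the tilted density again
   has mass 1. *)
have tilt (x : R) : normal_pdf m 1 x * expR (l * (x - m)) =
    expR (l ^+ 2 / 2) * normal_pdf (m + l) 1 x.
  rewrite !normal_pdf1E mulrCA -mulrA -!expRD.
  by congr (normal_peak 1 * expR _); field.
transitivity (\int[lebesgue_measure]_x ((expR (l ^+ 2 / 2))%:E * (normal_pdf (m + l) 1 x)%:E))%E.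
  by apply: eq_integral => x _; rewrite -EFinM -tilt.
rewrite ge0_integralZl//.
- by rewrite integral_normal_pdf mule1.
- by apply/measurable_EFinP; exact: measurable_normal_pdf.
- by move=> x _; rewrite lee_fin normal_pdf_ge0.
Qed.

(** Markov's inequality for exp (l S), where S is the centered sum and [l] <= 0 because the tail is
    a lower one. By independence the expectation is exp (l^2 / 2) to the power n. *)
Lemma normal_sum_tail (d : measure_display) (T : measurableType d) (R : realType)
    (P : probability T R) (I : set nat) (Z : nat -> {RV P >-> R}) (mu : nat -> R)
    (s : seq nat) (x : R) :
  mutually_independent P I Z ->
  (forall k, I k -> forall A, measurable A ->
     distribution P (Z k) A = normal_prob (mu k) 1 A) ->
  uniq s -> [set` s] `<=` I -> (0 < size s)%N -> 0 <= x ->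
  (P [set t | (\sum_(i <- s) (Z i t - mu i) <= - (x * Num.sqrt (size s)%:R))%R] <=
    (expR (- x ^+ 2 / 2))%:E)%E.
Proof.
move=> indep law us sI s0 x0.
set A := [set t | _].
have n0 : 0 < Num.sqrt (size s)%:R :> R by rewrite sqrtr_gt0 ltr0n.
(* the optimal Chernoff parameter *)
pose l : R := - (x / Num.sqrt (size s)%:R).
pose f i (y : R) := expR (l * (y - mu i)).
have mf i : measurable_fun setT (f i).
  by apply: measurableT_comp => //; apply: measurable_funM => //; exact: measurable_funB.
have mS : measurable_fun setT (fun t => \sum_(i <- s) (Z i t - mu i)).
  by apply: measurable_sum => i; exact: measurable_funB.
have mA : measurable A.
  rewrite -[A]setTI; exact: measurable_fun_le.
have prodE t : \prod_(i <- s) f i (Z i t) = expR (l * \sum_(i <- s) (Z i t - mu i)).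
  by rewrite mulr_sumr expR_sum.
have mprod : measurable_fun setT (fun t => \prod_(i <- s) f i (Z i t)).
  by apply: measurable_prod => i _; apply: measurableT_comp.
have fE i : I i ->
    (\int[distribution P (Z i)]_y (f i y)%:E = (expR (l ^+ 2 / 2))%:E)%E.
  by move=> Ii; apply: normal_prob_mgf => B mB; exact: law.
have intE : (\int[P]_t (\prod_(i <- s) f i (Z i t))%:E =
    (expR (l ^+ 2 / 2) ^+ size s)%:E)%E.
  have := @ge0_integral_prod_indep _ _ _ P I Z f (fun=> expR (l ^+ 2 / 2)) s indep mf
    (fun i y => expR_ge0 _) fE us sI fset0 (fun=> setT).
  have -> : \bigcap_(i in [set` fset0 : {fset nat}]) (Z i @^-1` setT) = setT.
    by apply/seteqP; split.
  rewrite big_seq_fset0 mule1.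
  rewrite big_const_seq count_predT iter_mulr_1.
  by apply.
have : ((expR (- l * (x * Num.sqrt (size s)%:R)))%:E * P A <=
   (expR (l ^+ 2 / 2) ^+ size s)%:E)%E.
  rewrite -intE -(integral_cst _ mA).
  apply: (@le_trans _ _ (\int[P]_(t in A) (\prod_(i <- s) f i (Z i t))%:E)%E).
    apply: ge0_le_integral => //.
    - by move=> t _; rewrite lee_fin expR_ge0.
    - by apply/measurable_EFinP/measurable_funTS.
    - move=> t At; rewrite lee_fin prodE ler_expR.
      rewrite mulNr -mulrN ler_wnM2l//.
      by rewrite oppr_le0 divr_ge0// ltW.
  apply: ge0_subset_integral => //; first by apply/measurable_EFinP.
  by move=> t _; rewrite lee_fin prodr_ge0// => i _; exact: expR_ge0.
have <- := @fineK _ (P A); last exact: fin_num_measure.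
rewrite -EFinM !lee_fin -expRM_natl -ler_pdivlMl ?expR_gt0// -expRN -expRD.
move/le_trans; apply; rewrite ler_expR le_eqVlt; apply/orP; left; apply/eqP.
have sn : Num.sqrt (size s)%:R ^+ 2 = (size s)%:R :> R by rewrite sqr_sqrtr.
have alg (l' q n : R) : q != 0 -> l' = - (x / q) -> q ^+ 2 = n ->
    - (- l' * (x * q)) + n * (l' ^+ 2 / 2) = - x ^+ 2 / 2.
  by move=> q0 -> <-; field.
exact: (alg l _ _ (lt0r_neq0 n0) erefl sn).
Qed.

Lemma Cconst_ge0 (R : realType) (k : nat) (g : R) : 0 <= Cconst k g.
Proof. by rewrite /Cconst mulr_ge0// sqrtr_ge0. Qed.

Lemma expR_Cconst_le (R : realType) (k : nat) (g : R) : (0 < k)%N -> 0 < g < 1 ->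
  expR (- Cconst k g ^+ 2 / 2) <= g.
Proof.
move=> k0 /andP[g0 g1].
have ln2 : 1 / 2 <= ln 2 :> R.
  rewrite -ler_expR lnK ?posrE//.
  have := expR_ge1Dx (- (1 / 2) : R).
  rewrite expRN => h; rewrite -lef_pV2 ?posrE ?expR_gt0//.
  by apply: le_trans h; lra.
(* The iterated logarithm is negative at k = 1; its least value ln (ln 2) is at least ln (1/2). *)
have lnk : - ln 2 <= ln (ln (2 * k%:R)) :> R.
  rewrite -lnV ?posrE// ler_ln ?posrE ?invr_gt0//.
    apply: (@le_trans _ _ (ln 2)); first by rewrite -div1r.
    by rewrite ler_ln ?posrE// ?mulr_gt0 ?ltr0n// ler_peMr// ler1n.
  by rewrite ln_gt0// -natrM ltr1n; lia.
(* 5.2 is rounded down to 4, so that 0.72 * 2 ln 2 outweighs the - ln 2 above. *)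
have ln52 : 2 * ln 2 - ln g <= ln (52 / 10 / g) :> R.
  rewrite ln_div ?posrE// lerD2r mulr_natl -lnXn// ler_ln ?posrE//.
  by rewrite -natrX ler_pdivlMr// -natrM ler_nat.
have lng : ln g < 0 by apply: ln_lt0; rewrite g0 g1.
(* (1.7)^2 / 2 * 0.72 = 1.0404 exceeds 1, and the constants left over are nonnegative. *)
rewrite -[leRHS]lnK ?posrE// ler_expR /Cconst exprMn sqr_sqrtr; last by lra.
lra.
Qed.

Lemma sig_ind_mul (R : realType) (m : R) : 0 <= m -> sig_ind m * m = m.
Proof.
rewrite le_eqVlt /sig_ind => /predU1P[<-|->]; last by rewrite mul1r.
by rewrite mulr0.
Qed.

Lemma Phi_inv_pval (R : realType) (x : R) : Phi_inv (1 - pval x) = x.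
Proof. by rewrite /pval subKr Phi_inv_Phi. Qed.

Lemma sum_Phi_inv_pval (R : realType) (m n : nat) (x : nat -> R) :
  \sum_(m <= i < n) Phi_inv (1 - pval (x i)) = \sum_(m <= i < n) x i.
Proof. by apply: eq_bigr => i _; exact: Phi_inv_pval. Qed.

Lemma measurable_stouffer_reject (d : measure_display) (T : measurableType d)
    (R : realType) (P : probability T R) (Z : nat -> {RV P >-> R}) (a : R) :
  measurable (stouffer_reject Z a).
Proof.
have -> : stouffer_reject Z a = \bigcup_(k in [set k | (0 < k)%N])
    [set w | Cconst k a * Num.sqrt k%:R <= \sum_(1 <= i < k.+1) Z i w].
  apply/seteqP; split=> [w [k [k0 H]]|w [k k0 H]]; exists k => //=.
    by move: H; rewrite sum_Phi_inv_pval.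
  by rewrite sum_Phi_inv_pval.
apply: bigcup_measurable => k _; rewrite -[X in measurable X]setTI.
by apply: measurable_fun_le => //; apply: measurable_sum.
Qed.

Lemma stouffer_power (d : measure_display) (T : measurableType d) (R : realType)
    (P : probability T R) (Z : nat -> {RV P >-> R}) (mu : nat -> R) (alpha beta : R)
    (k : nat) :
  mutually_independent P [set k | (0 < k)%N] Z ->
  (forall k, (0 < k)%N -> forall A, measurable A ->
     distribution P (Z k) A = normal_prob (mu k) 1 A) ->
  0 < beta < 1 -> (0 < k)%N ->
  (Cconst k alpha + Cconst k beta) * Num.sqrt k%:R <= \sum_(1 <= i < k.+1) mu i ->
  ((1 - beta)%:E <= P (stouffer_reject Z alpha))%E.
Proof.
move=> indep law beta01 k0 H.
have sk : size (index_iota 1 k.+1) = k by rewrite size_iota subn1.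
have := @normal_sum_tail _ _ _ P [set k | (0 < k)%N] Z mu (index_iota 1 k.+1)
  (Cconst k beta) indep law (iota_uniq _ _).
rewrite sk => /(_ _ k0 (Cconst_ge0 _ _ _)).
set A := [set t | (_ <= _)%R] => PA.
have {}PA : (P A <= beta%:E)%E.
  apply: le_trans (PA _) _ => [i /=|]; first by rewrite mem_index_iota => /andP[].
  by rewrite lee_fin expR_Cconst_le.
have mA : measurable A.
  rewrite -[A]setTI; apply: measurable_fun_le => //.
  by apply: measurable_sum => i; exact: measurable_funB.
apply: (@le_trans _ _ (P (~` A))).
  by rewrite probability_setC// EFinB leeB.
apply: le_measure.
- by apply/mem_set; exact: measurableC.
- by apply/mem_set; exact: measurable_stouffer_reject.
(* Off [A] the sum of the Z_i exceeds its mean less C_k^beta sqrt k, hence reaches C_k^alpha sqrt k: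
   the test rejects at this very [k]. *)
move=> t /= /negP; rewrite -ltNge sumrB ltrBrDl => tA.
exists k; split=> //; rewrite sum_Phi_inv_pval.
move: H; rewrite mulrDl; lra.
Qed.

(** * The Bonferroni test *)

Lemma normal_prob_pval_le (R : realType) (m a : R) (b : \bar R) : a < 1 -> (0 <= b)%E ->
  (forall u, (normal_prob 0 1 `[u, +oo[ <= a%:E)%E -> (normal_prob m 1 `[u, +oo[ <= b)%E) ->
  (normal_prob m 1 [set z | (pval z <= a)%R] <= b)%E.
Proof.
move=> a1 b0 H; have [->|[u [sub Nu]]] := @pval_le_ray R a a1.
  by rewrite measure0.
apply: le_trans (H _ Nu); apply: le_measure; rewrite ?inE//.
exact: measurable_pval_le.
Qed.

(** The tail beyond [L] obeys exp (- (L - m)^2 / 2) <= exp (L m) exp (- L^2 / 2), so both pieces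
    share the factor exp (L m). *)
Lemma normal_prob_pval_le_split (R : realType) (m a L : R) : 0 <= a < 1 -> 0 <= m <= L ->
  (normal_prob m 1 [set z | (pval z <= a)%R] <=
    (expR (L * m) * (a + expR (- L ^+ 2 / 2) / 2))%:E)%E.
Proof.
move=> /andP[a0 a1] /andP[m0 mL]; apply: normal_prob_pval_le => //.
  by rewrite lee_fin mulr_ge0 ?expR_ge0// addr_ge0// divr_ge0// expR_ge0.
move=> u Nu; apply: (le_trans (@normal_prob_ray_split _ m u L m0)).
rewrite mulrDr EFinD; apply: leeD.
  by rewrite EFinM lee_wpmul2l// lee_fin expR_ge0.
apply: (le_trans (@normal_prob_tail_le _ m L mL)).
rewrite lee_fin mulrA -expRD ler_pM2r ?invr_gt0// ler_expR; nra.
Qed.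

(** Centering the law moves the endpoint of the ray down by [m], which adds at most [m] to its null
    mass. *)
Lemma normal_prob_pval_le_lipschitz (R : realType) (m a : R) : 0 <= a < 1 -> 0 <= m ->
  (normal_prob m 1 [set z | (pval z <= a)%R] <= (a + m)%:E)%E.
Proof.
move=> /andP[a0 a1] m0; apply: normal_prob_pval_le => //.
  by rewrite lee_fin addr_ge0.
move=> u Nu; have := @normal_prob_shift R 0 1 m (u - m) (oner_neq0 _).
rewrite add0r subrK => ->.
have um : u - m <= u by rewrite gerBl.
apply: (le_trans (@normal_prob_ray_lipschitz R 0 _ _ um)).
by rewrite subKr EFinD; apply: leeD.
Qed.

(** The null tail at [y] exceeds [a], so the rejection ray starts no earlier than y >= m + t; the
    upper tail bound then applies at distance [t] from the mean. *)
Lemma normal_prob_pval_le_far (R : realType) (m a y t : R) :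
  a <= expR (- y ^+ 2) / 4 -> 0 <= t -> m + t <= y -> 0 <= m ->
  (normal_prob m 1 [set z | (pval z <= a)%R] <= (expR (- t ^+ 2 / 2) / 2)%:E)%E.
Proof.
move=> ay t0 mty m0; have y0 : 0 <= y by lra.
apply: normal_prob_pval_le.
- apply: (le_lt_trans ay).
  have : expR (- y ^+ 2) <= 1 by rewrite expR_le1 oppr_le0 sqr_ge0.
  by lra.
- by rewrite lee_fin divr_ge0// expR_ge0.
move=> u Nu.
have yu : y <= u.
  rewrite leNgt; apply/negP => uy.
  have := @normal_prob_tail_gt R y y0; apply/negP; rewrite -leNgt.
  apply: (@le_trans _ _ a%:E); last by rewrite lee_fin.
  apply: le_trans Nu; apply: le_measure; rewrite ?inE//.
  by move=> x /=; rewrite !in_itv/= !andbT; lra.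
apply: (@le_trans _ _ (normal_prob m 1 `[m + t, +oo[)).
  apply: le_measure; rewrite ?inE//.
  by move=> x /=; rewrite !in_itv/= !andbT; lra.
apply: (le_trans (@normal_prob_tail_le R m (m + t) _)); first by lra.
by rewrite addrC addKr.
Qed.

Lemma bonf_power_le (d : measure_display) (T : measurableType d) (R : realType)
    (P : probability T R) (Z : nat -> {RV P >-> R}) (mu a q : nat -> R) (b : R) :
  (forall k, (0 < k)%N -> forall A, measurable A ->
     distribution P (Z k) A = normal_prob (mu k) 1 A) ->
  (forall k, (0 < k)%N ->
    (normal_prob (mu k) 1 [set z | (pval z <= a k)%R] <= (q k)%:E)%E) ->
  (forall n, \sum_(1 <= k < n) q k <= b) ->
  (P (bonf_reject Z a) <= b%:E)%E.
Proof.
move=> law aq qb.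
(* Steps are numbered from 1, countable unions from 0. *)
pose F n := Z n.+1 @^-1` [set z | pval z <= a n.+1].
have mF n : measurable (F n).
  by rewrite -[X in measurable X]setTI; apply: measurable_funPT => //; exact: measurable_pval_le.
have FE : bonf_reject Z a = \bigcup_n F n.
  apply/seteqP; split=> [w [k [k0 H]]|w [k _ H]].
    by exists k.-1; rewrite /F/= ?prednK.
  by exists k.+1.
have mbF : measurable (\bigcup_n F n) by exact: bigcup_measurable.
rewrite FE; apply: (le_trans (measure_sigma_subadditive P mF mbF (@subset_refl _ _))).
apply: lime_le; first exact: is_cvg_nneseries.
apply: nearW => n; apply: (@le_trans _ _ (\sum_(0 <= k < n) (q k.+1)%:E)%E).
  apply: lee_sum => k _; apply: le_trans (aq _ (ltn0Sn k)).
  by rewrite -(law _ (ltn0Sn k))//; exact: measurable_pval_le.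
by rewrite sumEFin lee_fin -(big_add1 _ _ 0 n.+1 xpredT q).
Qed.

(** * Elementary sums and numerical constants *)

Lemma partial_sum_le (R : realType) (a : nat -> R) (s : R) :
  (forall k, (0 < k)%N -> 0 <= a k) ->
  (fun n => \sum_(1 <= k < n) a k) @ \oo --> s ->
  forall n, \sum_(1 <= k < n) a k <= s.
Proof.
move=> a0 as_ n; rewrite -(cvg_lim _ as_)//.
apply: (@nondecreasing_cvgn_le _ (fun n => \sum_(1 <= k < n) a k)); last by apply/cvg_ex; exists s.
apply/nondecreasing_seqP => -[|k]; first by rewrite !big_geq.
by rewrite [leRHS]big_nat_recr//= lerDl a0.
Qed.

Lemma term_le_sum (R : realType) (a : nat -> R) (k : nat) :
  (forall k, (0 < k)%N -> 0 <= a k) -> (0 < k)%N -> a k <= \sum_(1 <= i < k.+1) a i.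
Proof.
move=> a0 k0; rewrite big_nat_recr//= lerDr big_nat sumr_ge0// => i /andP[i0 _].
exact: a0.
Qed.

Lemma sum_inv_sqr_le (R : realType) (n : nat) : \sum_(1 <= k < n) (k%:R ^+ 2)^-1 <= 2 :> R.
Proof.
(* The subtracted inverse makes the induction telescope: 1 / (x + 1)^2 <= 1 / x - 1 / (x + 1). *)
have H m : \sum_(1 <= k < m.+2) (k%:R ^+ 2)^-1 <= 2 - m.+1%:R^-1 :> R.
  elim: m => [|m IH]; first by rewrite big_nat1 expr1n invr1; lra.
  rewrite big_nat_recr//=; apply: (le_trans (lerD IH (lexx _))).
  rewrite -[m.+2%:R]natr1; have : 0 < m.+1%:R :> R by rewrite ltr0n.
  move: (m.+1%:R) => x x0.
  have -> : 2 - x^-1 + ((x + 1) ^+ 2)^-1 = 2 - (x + 1)^-1 - (x * (x + 1) ^+ 2)^-1.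
    by field; lra.
  by rewrite gerBl invr_ge0 mulr_ge0 ?sqr_ge0// ltW.
case: n => [|[|m]]; [by rewrite big_geq|by rewrite big_geq|].
by apply: (le_trans (H m)); rewrite gerBl invr_ge0.
Qed.

Lemma expR_quarter_le (R : realType) : expR (1 / 4) <= 4 / 3 :> R.
Proof.
have := expR_ge1Dx (- (1 / 4) : R); rewrite expRN => h.
rewrite -lef_pV2 ?posrE ?expR_gt0//.
by apply: le_trans h; rewrite invf_div; lra.
Qed.

Lemma ln4_ge1 (R : realType) : 1 <= ln 4 :> R.
Proof.
rewrite -ler_expR lnK ?posrE//.
have -> : 1 = 4%:R * (1 / 4) :> R by rewrite mulrC divfK.
rewrite expRM_natl; apply: (@le_trans _ _ ((4 / 3) ^+ 4)).
  by rewrite ler_pXn2r ?nnegrE ?expR_ge0//; exact: expR_quarter_le.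
by lra.
Qed.

(** * Signal strengths necessary for Bonferroni power *)

Lemma bonf_infinite (d : measure_display) (T : measurableType d) (R : realType)
    (P : probability T R) (Z : nat -> {RV P >-> R}) (mu : nat -> R)
    (alpha b : R) (alphas : nat -> R) :
  (forall k, (0 < k)%N -> forall A, measurable A ->
     distribution P (Z k) A = normal_prob (mu k) 1 A) ->
  (forall k, (0 < k)%N -> 0 <= mu k) ->
  0 < alpha <= 1 / 4 -> 4 * alpha <= b ->
  (forall k, (0 < k)%N -> 0 <= alphas k) ->
  (forall n, \sum_(1 <= k < n) alphas k <= alpha) ->
  (b%:E <= P (bonf_reject Z alphas))%E ->
  exists k, (0 < k)%N /\
    (1 / 4) * (Num.sqrt (2 * ln (k%:R ^+ 2 / alpha)))^-1 <= mu k.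
Proof.
move=> law mu0 /andP[al0 al14] alb a0 aS power; apply: contrapT => /forallNP H.
have {}H k : (0 < k)%N -> mu k < (1 / 4) * (Num.sqrt (2 * ln (k%:R ^+ 2 / alpha)))^-1.
  by move=> k0; rewrite ltNge; apply/negP => h; apply: (H k).
pose c : R := expR (1 / 4).
have : (P (bonf_reject Z alphas) <= (c * 2 * alpha)%:E)%E.
  apply: (@bonf_power_le _ _ _ P Z mu alphas
      (fun k => c * (alphas k + alpha / 2 * (k%:R ^+ 2)^-1)) _ law) => [k k0|n].
    have k1 : 1 <= k%:R :> R by rewrite ler1n.
    (* From alpha <= 1/4. It gives L >= 1, so that L mu_k <= 1/4 also yields mu_k <= L. *)
    have q4 : 4 <= k%:R ^+ 2 / alpha.
      by rewrite ler_pdivlMr//; nra.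
    have q0 : 0 < k%:R ^+ 2 / alpha by lra.
    have := H _ k0; set L := Num.sqrt _ => muL.
    have lnq : 1 <= ln (k%:R ^+ 2 / alpha).
      by apply: (le_trans (ln4_ge1 R)); rewrite ler_ln ?posrE.
    have L2 : L ^+ 2 = 2 * ln (k%:R ^+ 2 / alpha) by rewrite sqr_sqrtr//; lra.
    have L1 : 1 <= L by rewrite -[1]sqrtr1 ler_sqrt; lra.
    have muL' : L * mu k <= 1 / 4.
      by rewrite mulrC -ler_pdivlMr ?ltW//; lra.
    have m0 := mu0 _ k0.
    have ak1 : 0 <= alphas k < 1.
      rewrite a0//= ; apply: (@le_lt_trans _ _ alpha); last by lra.
      by apply: le_trans (aS k.+1); exact: term_le_sum.
    have mL : 0 <= mu k <= L by rewrite m0/=; nra.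
    apply: (le_trans (@normal_prob_pval_le_split _ _ _ L ak1 mL)).
    rewrite lee_fin L2 [- _ / 2](_ : _ = - ln (k%:R ^+ 2 / alpha)); last by field.
    rewrite expRN lnK ?posrE// invf_div.
    have -> : alpha / k%:R ^+ 2 / 2 = alpha / 2 * (k%:R ^+ 2)^-1.
      by rewrite mulrAC.
    rewrite ler_wpM2r ?ler_expR// addr_ge0 ?a0// mulr_ge0//; by lra.
  rewrite -mulr_sumr big_split/= -mulr_sumr -[leRHS]mulrA ler_wpM2l ?expR_ge0//.
  have := sum_inv_sqr_le R n; have := aS n; nra.
move/(le_trans power); rewrite lee_fin => bc.
(* 2 c alpha <= 8/3 alpha, strictly below 4 alpha <= b. *)
have := expR_quarter_le R; rewrite -/c; nra.
Qed.

(** The levels cost [alpha] in all and the at most [M] signals share an excess of 3/5 alpha + delta,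
    with delta = 1 - beta - 3 alpha; the total 1 - beta - 7/5 alpha is too small. As [kstar] is
    real, its level is read at its floor, or at 1 if that is 0. *)
Lemma bonf_finite (d : measure_display) (T : measurableType d) (R : realType)
    (P : probability T R) (Z : nat -> {RV P >-> R}) (mu : nat -> R)
    (alpha beta M : R) (alphas : nat -> R) :
  (forall k, (0 < k)%N -> forall A, measurable A ->
     distribution P (Z k) A = normal_prob (mu k) 1 A) ->
  (forall k, (0 < k)%N -> 0 <= mu k) ->
  0 < alpha < 1 -> 0 < beta < 1 -> alpha <= (1 - beta) / 4 ->
  (forall k, (0 < k)%N -> 0 <= alphas k) ->
  (forall n, \sum_(1 <= k < n) alphas k <= alpha) ->
  (forall n, \sum_(1 <= k < n) sig_ind (mu k) <= M) ->
  (forall k, (0 < k)%N -> alphas k.+1 <= alphas k) ->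
  ((1 - beta)%:E <= P (bonf_reject Z alphas))%E ->
  let kstar := M ^+ 2 / alpha in
  exists k, (0 < k)%N /\
    (if k%:R <= kstar
     then (2 / 5) * Num.sqrt (alphas (maxn 1 (Num.truncn kstar))) <= mu k
     else Num.sqrt (ln (k%:R / (4 * alpha)))
            - Num.sqrt (2 * ln (M / (2 * (1 - beta - 3 * alpha))))
          <= mu k).
Proof.
move=> law mu0 /andP[al0 al1] /andP[be0 be1] alb a0 aS rM aD power kstar.
apply: contrapT => /forallNP H.
pose delta := 1 - beta - 3 * alpha.
have delta0 : 0 < delta by rewrite /delta; lra.
have r0 k : (0 < k)%N -> 0 <= sig_ind (mu k) by rewrite /sig_ind; case: ifP.
have M0 : 0 <= M by have := rM 0%N; rewrite big_geq.
(* By monotonicity each of the first [k] levels is at least [alphas k], and they sum to at most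
   [alpha]. *)
have ak k : (0 < k)%N -> alphas k <= alpha / k%:R.
  move=> k0; rewrite ler_pdivlMr ?ltr0n//.
  apply: le_trans (aS k.+1).
  have -> : alphas k * k%:R = \sum_(1 <= i < k.+1) alphas k.
    by rewrite sumr_const_nat subn1 mulr_natr.
  rewrite big_nat [leRHS]big_nat; apply: ler_sum => i /andP[i0 ik].
  have : (i <= k)%N by [].
  elim: {+}k => [|j IH]; first by rewrite leqn0 => /eqP ->.
  rewrite leq_eqVlt => /predU1P[->//|ij].
  by apply: le_trans (IH ij); apply: aD; apply: leq_trans i0 _.
have ak1 k : (0 < k)%N -> 0 <= alphas k < 1.
  move=> k0; rewrite a0//=; apply: (@le_lt_trans _ _ alpha) => //.
  by apply: le_trans (aS k.+1); exact: term_le_sum.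
(* c = 0 if M = 0, in which case there is no signal *)
pose c : R := (3 / 5 * alpha + delta) / M.
have c0 : 0 <= c by rewrite divr_ge0// ; lra.
have : (P (bonf_reject Z alphas) <= (alpha + c * M)%:E)%E.
  apply: (@bonf_power_le _ _ _ P Z mu alphas
      (fun k => alphas k + c * sig_ind (mu k)) _ law) => [k k0|n]; last first.
    by rewrite big_split/= -mulr_sumr lerD// ler_wpM2l.
  have [mu_eq0|mu_neq0] := eqVneq (mu k) 0.
    apply: (le_trans (@normal_prob_pval_le_lipschitz _ _ _ (ak1 k k0) (mu0 k k0))).
    by rewrite lee_fin mu_eq0 /sig_ind ltxx mulr0.
  have mu_gt0 : 0 < mu k by rewrite lt_neqAle eq_sym mu_neq0 mu0.
  have rk : sig_ind (mu k) = 1 by rewrite /sig_ind mu_gt0.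
  (* A signal forces M >= 1, hence kstar >= 1 and a positive floor. *)
  have M1 : 1 <= M by rewrite -rk; apply: le_trans (rM k.+1); exact: term_le_sum.
  have ks1 : 1 <= kstar by rewrite ler_pdivlMr// mul1r; nra.
  rewrite rk mulr1.
  have Hk := H k; have [kk|kk] := leP k%:R kstar; rewrite ?kk in Hk.
    have {Hk} : mu k < 2 / 5 * Num.sqrt (alphas (maxn 1 (Num.truncn kstar))).
      by rewrite ltNge; apply/negP => h; exact: Hk.
    have K0 : (0 < Num.truncn kstar)%N by rewrite truncn_gt0.
    rewrite (maxn_idPr K0); set K := Num.truncn kstar in K0 *.
    (* Taking the floor loses at most a factor 2, whence alphas K <= 2 (alpha / M)^2. Below, 3/2
       stands for sqrt 2, and 2/5 * 3/2 = 3/5. *)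
    have KK : kstar <= 2 * K%:R.
      have : kstar < K.+1%:R by exact: truncnS_gt.
      have : 1 <= K%:R :> R by rewrite ler1n.
      by rewrite -natr1; lra.
    have aK : alphas K <= (3 / 2 * alpha / M) ^+ 2.
      apply: (le_trans (ak K K0)); rewrite ler_pdivrMr ?ltr0n//.
      have MK : M ^+ 2 <= 2 * K%:R * alpha by rewrite -ler_pdivrMr.
      rewrite !expr_div_n mulrAC ler_pdivlMr ?exprn_gt0//; last by lra.
      by nra.
    have sK : Num.sqrt (alphas K) <= 3 / 2 * alpha / M.
      have s0 : 0 <= 3 / 2 * alpha / M by rewrite divr_ge0//; lra.
      by rewrite -[leRHS]ger0_norm// -sqrtr_sqr ler_sqrt ?sqr_ge0.
    move=> muk.
    apply: (le_trans (@normal_prob_pval_le_lipschitz _ _ _ (ak1 k k0) (mu0 k k0))).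
    rewrite lee_fin lerD2l /c.
    apply: (@le_trans _ _ (3 / 5 * alpha / M)).
      have -> : 3 / 5 * alpha / M = 2 / 5 * (3 / 2 * alpha / M) by field; lra.
      by lra.
    by rewrite ler_pM2r ?invr_gt0; lra.
  rewrite leNgt kk /= in Hk.
  set y := Num.sqrt (ln (k%:R / (4 * alpha))) in Hk.
  set t := Num.sqrt (2 * _) in Hk.
  have {}Hk : mu k + t <= y.
    by rewrite leNgt; apply/negP => h; apply: Hk; split=> //; lra.
  have k1 : 1 <= k%:R :> R by rewrite ler1n.
  have q1 : 1 <= k%:R / (4 * alpha) by rewrite ler_pdivlMr; lra.
  have y2 : y ^+ 2 = ln (k%:R / (4 * alpha)) by rewrite sqr_sqrtr// ln_ge0.
  (* The right-hand side is exactly alpha / k. *)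
  have aky : alphas k <= expR (- y ^+ 2) / 4.
    apply: (le_trans (ak k k0)); rewrite y2 expRN lnK ?posrE; last by lra.
    by rewrite invf_div [leRHS](_ : _ = alpha / k%:R)//; field; lra.
  have t0 : 0 <= t by exact: sqrtr_ge0.
  apply: (le_trans (@normal_prob_pval_le_far _ _ _ y t aky t0 Hk (mu0 k k0))).
  rewrite lee_fin; apply: (@le_trans _ _ (delta / M)); last first.
    apply: (@le_trans _ _ c); last by rewrite lerDr a0.
    by rewrite ler_pM2r ?invr_gt0; lra.
  have q0 : 0 < M / (2 * delta) by rewrite divr_gt0; lra.
  (* If the logarithm in [t] is nonnegative, exp (- t^2 / 2) / 2 equals delta / M. Otherwise
     [Num.sqrt] gives t = 0, and 1/2 < delta / M. *)
  have [h1|h1] := leP 1 (M / (2 * delta)).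
    have t2 : t ^+ 2 = 2 * ln (M / (2 * delta)).
      by rewrite sqr_sqrtr// mulr_ge0// ln_ge0.
    rewrite t2 [- _ / 2](_ : _ = - ln (M / (2 * delta))); last by field.
    rewrite expRN lnK ?posrE// invf_div le_eqVlt; apply/orP; left; apply/eqP.
    by field; lra.
  have : expR (- t ^+ 2 / 2) <= 1.
    by rewrite expR_le1 mulNr oppr_le0 divr_ge0// sqr_ge0.
  move: h1; rewrite ltr_pdivrMr ?mul1r; last by lra.
  move=> h1 h2; apply: (@le_trans _ _ (1 / 2)); first by lra.
  by rewrite ler_pdivlMr; lra.
move/(le_trans power); rewrite lee_fin.
have : c * M <= 3 / 5 * alpha + delta.
  have [->|Mn0] := eqVneq M 0; first by rewrite mulr0; lra.
  by rewrite divfK.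
rewrite /delta; lra.
Qed.

Theorem theorem6 (d : measure_display) (T : measurableType d) (R : realType)
  (P : probability T R) (Z : nat -> {RV P >-> R}) (mu : nat -> R)
  (alpha beta : R) (alphas : nat -> R) :
  mutually_independent P [set k | (0 < k)%N] Z ->
  (forall k, (0 < k)%N -> forall A, measurable A ->
     distribution P (Z k) A = normal_prob (mu k) 1 A) ->
  (forall k, (0 < k)%N -> 0 <= mu k) ->
  0 < alpha < 1 -> 0 < beta < 1 -> alpha <= (1 - beta) / 4 ->
  (forall k, (0 < k)%N -> 0 <= alphas k) ->
  (fun n => \sum_(1 <= k < n) alphas k) @ \oo --> alpha ->
  (* (i) *)
  ((\sum_(1 <= k <oo) (sig_ind (mu k))%:E = +oo)%E ->
   ((1 - beta)%:E <= P (bonf_reject Z alphas))%E ->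
   exists k, (0 < k)%N /\
     (1 / 4) * (Num.sqrt (2 * ln (k%:R ^+ 2 / alpha)))^-1 <= sig_ind (mu k) * mu k)
  /\
  (* (ii) *)
  (forall M : R,
   (\sum_(1 <= k <oo) (sig_ind (mu k))%:E <= M%:E)%E ->
   (forall k, (0 < k)%N -> alphas k.+1 <= alphas k) ->
   ((1 - beta)%:E <= P (bonf_reject Z alphas))%E ->
   let kstar := M ^+ 2 / alpha in
   exists k, (0 < k)%N /\
     (if k%:R <= kstar
      then (2 / 5) * Num.sqrt (alphas (maxn 1 (Num.truncn kstar))) <= sig_ind (mu k) * mu k
      else Num.sqrt (ln (k%:R / (4 * alpha)))
             - Num.sqrt (2 * ln (M / (2 * (1 - beta - 3 * alpha))))
           <= sig_ind (mu k) * mu k))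
  /\
  (* (iii) *)
  ((exists k, (0 < k)%N /\
     (Cconst k alpha + Cconst k beta) * Num.sqrt k%:R
       <= \sum_(1 <= i < k.+1) mu i * sig_ind (mu i)) ->
   ((1 - beta)%:E <= P (stouffer_reject Z alpha))%E).
Proof.
move=> indep law mu0 alpha01 beta01 alb a0 acvg.
have /andP[al0 al1] := alpha01; have /andP[be0 be1] := beta01.
have aS := @partial_sum_le _ alphas alpha a0 acvg.
(* The indicator is absorbed by a nonnegative mean, which is why the lemmas speak of mu_k alone. *)
have muE k : (0 < k)%N -> sig_ind (mu k) * mu k = mu k by move=> k0; rewrite sig_ind_mul// mu0.
split=> [_ power|]; [|split=> [M rM aD power kstar|[k [k0 H]]]].
- have [||k [k0 Hk]] := @bonf_infinite _ _ _ P Z mu alpha (1 - beta) alphas law mu0 _ _ a0 aS power.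
  + by rewrite al0/=; lra.
  + by lra.
  + by exists k; rewrite muE.
- have r0 k : (0 <= (sig_ind (mu k))%:E)%E by rewrite lee_fin /sig_ind; case: ifP.
  have rS n : \sum_(1 <= k < n) sig_ind (mu k) <= M.
    rewrite -lee_fin -sumEFin; apply: le_trans rM.
    exact: nneseries_lim_ge.
  have [k [k0 Hk]] := @bonf_finite _ _ _ P Z mu alpha beta M alphas law mu0
    alpha01 beta01 alb a0 aS rS aD power.
  by exists k; rewrite muE.
- apply: (@stouffer_power _ _ _ P Z mu alpha beta k indep law beta01 k0).
  apply: (le_trans H); rewrite big_nat [leRHS]big_nat le_eqVlt; apply/orP; left.
  by apply/eqP/eq_bigr => i /andP[i0 _]; rewrite mulrC muE.
Qed.
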